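(* Let $P\subseteq \mathbb{R}\times M_{\mathbb{R}}$ be a full-dimensional lattice polytope (with respect to the lattice $\mathbb{Z}\times M$) of lattice width $2$ with $P\subseteq[-1,1]\times M_{\mathbb{R}}$, and let $P_0\subseteq M_{\mathbb{R}}$ be its middle polytope. Then the Fine interior of $P$ is $$F(P)=F_1(P)\cap F_2(P),$$ where $$F_1(P):=\{0\}\times\{x\in M_{\mathbb{R}} \mid \langle x,n\rangle\ge \mathrm{Min}_{P_0}(n)+1\ \ \forall n\in N_1(P_0)\},$$ $$F_2(P):=\{0\}\times\{x\in M_{\mathbb{R}} \mid \langle x,2n\rangle\ge \mathrm{Min}_{P_0}(2n)+1\ \ \forall n\in N_2(P_0)\}.$$ In particular, $F(P)$ is completely determined by $P_0$.
   Context: $M\cong\mathbb{Z}^r$ ($r\ge1$) is a lattice, $N=\mathrm{Hom}(M,\mathbb{Z})$ its dual lattice, $M_{\mathbb{R}}=M\otimes\mathbb{R}$, and $\langle\cdot,\cdot\rangle$ the natural pairing. The ambient space $\mathbb{R}\times M_{\mathbb{R}}$ carries the lattice $\mathbb{Z}\times M$ with dual lattice $\mathbb{Z}\times N$ and pairing $\langle (x_0,x),(n_0,n)\rangle=x_0n_0+\langle x,n\rangle$. For a lattice $L$ with dual lattice $L^*$, a polytope $Q\subseteq L_{\mathbb{R}}$ and $n\in L^*$, put $\mathrm{Min}_Q(n)=\min\{\langle x,n\rangle\mid x\in Q\}$. The Fine interior of $Q$ is $F(Q)=\{x\in L_{\mathbb{R}}\mid \langle x,n\rangle\ge \mathrm{Min}_Q(n)+1\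 \forall n\in L^*\setminus\{0\}\}$. The lattice width of $Q$ is $\mathrm{lw}(Q)=\min\{-\mathrm{Min}_Q(-n)-\mathrm{Min}_Q(n)\mid n\in L^*\setminus\{0\}\}$. For a lattice polytope $P\subseteq[-1,1]\times M_{\mathbb{R}}$ of lattice width $2$, the middle polytope $P_0\subseteq M_{\mathbb{R}}$ is defined by $\{0\}\times P_0=P\cap(\{0\}\times M_{\mathbb{R}})$; it is half-integral, i.e. its vertices lie in $\tfrac12M$. Put $N_1(P_0)=\{n\in N\setminus\{0\}\mid \mathrm{Min}_{P_0}(n)\in\mathbb{Z}\}$ and $N_2(P_0)=\{n\in N\setminus\{0\}\mid \mathrm{Min}_{P_0}(n)\notin\mathbb{Z}\}$. *)

(* Defs.v *)
From HB Require Import structures.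
From mathcomp Require Export all_boot all_order all_algebra.
From mathcomp Require Export boolp classical_sets reals.

Set Implicit Arguments.
Unset Strict Implicit.
Unset Printing Implicit Defensive.

Import Order.TTheory GRing.Theory Num.Theory.

Local Open Scope classical_set_scope.
Local Open Scope ring_scope.

(* Coordinates are fixed on the lattice: M = Z^k is 'rV[int]_k, M_R is 'rV[R]_k
   and the dual lattice N = Hom(M, Z) is 'cV[int]_k, acting on M_R by matrix
   multiplication on the right.  For M = Z^r the lattice Z x M is
   'rV[int]_(1 + r), and the point (x0, x) of R x M_R is row_mx x0%:M x. *)

Section Lattice.
Variables (R : realType) (k : nat).
Implicit Types (A Q : set 'rV[R]_k) (n : 'cV[int]_k).

Definition pairing (x : 'rV[R]_k) n : R :=
  (x *m map_mx (fun z : int => z%:~R) n) 0 0.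

Definition convex_hull A : set 'rV[R]_k :=
  [set x | exists (m : nat) (w : 'I_m -> R) (v : 'I_m -> 'rV[R]_k),
     [/\ forall i, A (v i), forall i, 0 <= w i, \sum_i w i = 1 &
         x = \sum_i w i *: v i]].

Definition affine_hull A : set 'rV[R]_k :=
  [set x | exists (m : nat) (w : 'I_m -> R) (v : 'I_m -> 'rV[R]_k),
     [/\ forall i, A (v i), \sum_i w i = 1 & x = \sum_i w i *: v i]].

Definition lattice_polytope Q : Prop :=
  exists s : seq 'rV[int]_k,
    Q = convex_hull [set x | exists2 u, u \in s &
                       x = map_mx (fun z : int => z%:~R) u].

Definition full_dimensional Q : Prop := affine_hull Q = setT.

(* The least element of A; the value 0 is returned only if A has none. *)
Definition minimum (A : set R) : R := xget 0 (A `&` lbound A).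

Definition Min Q n : R := minimum [set pairing x n | x in Q].

Definition Fine_interior Q : set 'rV[R]_k :=
  [set x | forall n, n != 0 -> pairing x n >= Min Q n + 1].

Definition lattice_width Q : R :=
  minimum [set - Min Q (- n) - Min Q n | n in [set n | n != 0]].

Lemma minimumE (A : set R) (a : R) : A a -> lbound A a -> minimum A = a.
Proof.
move=> Aa lba; apply: xget_unique => [|b [Ab lbb]]; first by split.
by apply/eqP; rewrite eq_le (lbb _ Aa) (lba _ Ab).
Qed.

End Lattice.

Lemma pairing_row_col (R : realType) (r : nat) (x0 : R) (x : 'rV[R]_r)
    (n0 : int) (n : 'cV[int]_r) :
  pairing (row_mx x0%:M x) (col_mx n0%:M n) = x0 * n0%:~R + pairing x n.
Proof.
by rewrite /pairing map_col_mx mul_row_col !mxE big_ord1 !mxE eqxx !mulr1n.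
Qed.

Section Middle.
Variables (R : realType) (r : nat).
Implicit Types (P : set 'rV[R]_(1 + r)).

(* [-1, 1] x M_R *)
Definition slab : set 'rV[R]_(1 + r) :=
  [set y | -1 <= lsubmx y 0 0 <= 1].

(* {0} x S *)
Definition at_height0 (S : set 'rV[R]_r) : set 'rV[R]_(1 + r) :=
  [set row_mx 0 x | x in S].

Definition middle P : set 'rV[R]_r := [set x | P (row_mx 0 x)].

Definition N1 (P0 : set 'rV[R]_r) : set 'cV[int]_r :=
  [set n | n != 0 /\ Min P0 n \is a Num.int].

Definition N2 (P0 : set 'rV[R]_r) : set 'cV[int]_r :=
  [set n | n != 0 /\ Min P0 n \isn't a Num.int].

Definition F1 P : set 'rV[R]_(1 + r) :=
  at_height0 [set x | forall n, N1 (middle P) n ->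
                        pairing x n >= Min (middle P) n + 1].

Definition F2 P : set 'rV[R]_(1 + r) :=
  at_height0 [set x | forall n, N2 (middle P) n ->
                        pairing x (n *+ 2) >= Min (middle P) (n *+ 2) + 1].

Lemma middleE P : at_height0 (middle P) = P `&` at_height0 setT.
Proof.
apply/seteqP; split=> [_ [x Px <-]|y [Py [x _ xE]]].
  by split=> //; exists x.
by exists x => //; rewrite /middle /= xE.
Qed.

End Middle.

(* Main.v *)
Require Import Defs.
From mathcomp Require Import ring lra zify.
Import Order.TTheory GRing.Theory Num.Theory.
Local Open Scope classical_set_scope.
Local Open Scope ring_scope.

(** Write [P] as the convex hull of lattice points of heights -1, 0 and 1.
    The directions [(1, 0)] and [(-1, 0)] force the Fine interior into height 0,
    and there no direction [(n0, 0)] cuts it further: width 2 puts generators on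
    both walls of the slab ([generators_on_walls]), so [Min P (n0, 0) <= -1].
    At height 0, all directions [(n0, n)] over a fixed nonzero [n] constrain the
    same number [<x, n>], so that only the largest of the integers
    [Min P (n0, n)] matters.  The heart of the matter is that this largest value
    is the integer part of [m := Min P0 n].

    It is at most [m] because [P] contains [{0} x P0].  For the converse, let
    [a] and [b] be the minima of [n] over the generators of heights 1 and -1.
    The midpoint of the two minimizers lies in [P0], hence [2 m <= a + b], and
    tilting [n] by [n0 := floor m - a] raises the minimum over each of the three
    heights to at least [floor m] ([exists_tilt]).

    So [F(P)] consists of the points [(0, x)] with [<x, n> >= floor m + 1] for
    all nonzero [n].  Finally [m] is the smaller of [(a + b) / 2] and of the
    minimum over the generators of height 0 ([middle_Min]); hence [2 m] is an
    integer, and [floor m + 1] is [m + 1] or [m + 1/2] according to whether [m]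
    is an integer.  These two cases are the inequalities defining [F1] and [F2]
    ([F1I_F2E]). *)

(** * The pairing and minima over lattice polytopes *)

Lemma seq_argmin (T : eqType) (s : seq T) (p : pred T) (f : T -> int) :
  has p s -> exists u, [/\ u \in s, p u &
                         forall v, v \in s -> p v -> f u <= f v].
Proof.
elim: s => //= t s IH; have [/IH[u [us pu umin]] _|ps] := boolP (has p s).
  have [tu|ut] := boolP (p t && (f t <= f u)).
    case/andP: tu => pt tu; exists t; split; rewrite ?mem_head // => v.
    by rewrite inE => /predU1P[->//|vs pv]; exact: le_trans tu (umin _ vs pv).
  exists u; split; rewrite ?inE ?us ?orbT // => v.
  rewrite inE => /predU1P[->|]; last exact: umin.
  by move=> pt; move: ut; rewrite pt /= -ltNge => /ltW.
rewrite orbF => pt; exists t; split; rewrite ?mem_head // => v.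
by rewrite inE => /predU1P[->//|vs pv]; case/hasP: ps; exists v.
Qed.

Arguments seq_argmin {T} s p f _.

Section Pairing.
Set Implicit Arguments.
Unset Strict Implicit.
Variables (R : realType) (k : nat).
Implicit Types (x : 'rV[R]_k) (u : 'rV[int]_k) (n : 'cV[int]_k).

Definition lattice_point u : 'rV[R]_k := map_mx (fun z : int => z%:~R) u.

Definition int_pairing u n : int := (u *m n) 0 0.

Lemma pairing_lattice_point u n :
  pairing (lattice_point u) n = (int_pairing u n)%:~R.
Proof.
rewrite /pairing /int_pairing !mxE rmorph_sum /=.
by apply: eq_bigr => i _; rewrite !mxE rmorphM.
Qed.

Lemma pairingD x y n : pairing (x + y) n = pairing x n + pairing y n.
Proof. by rewrite /pairing mulmxDl mxE. Qed.

Lemma pairingZ (a : R) x n : pairing (a *: x) n = a * pairing x n.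
Proof. by rewrite /pairing -scalemxAl mxE. Qed.

Lemma pairing_sum m (F : 'I_m -> 'rV[R]_k) n :
  pairing (\sum_i F i) n = \sum_i pairing (F i) n.
Proof. by rewrite /pairing mulmx_suml summxE. Qed.

Lemma pairingNr x n : pairing x (- n) = - pairing x n.
Proof.
rewrite /pairing !mxE -sumrN; apply: eq_bigr => i _.
by rewrite !mxE rmorphN mulrN.
Qed.

Lemma pairing_mulr2n x n : pairing x (n *+ 2) = pairing x n *+ 2.
Proof.
rewrite /pairing !mxE -sumrMnl; apply: eq_bigr => i _.
by rewrite !mxE rmorphD mulrDr -mulr2n.
Qed.

Lemma MinE (Q : set 'rV[R]_k) n x :
  Q x -> (forall y, Q y -> pairing x n <= pairing y n) -> Min Q n = pairing x n.
Proof.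
move=> Qx xmin; apply: minimumE; first by exists x.
by move=> _ [y Qy <-]; exact: xmin.
Qed.

Lemma Min_set0 n : Min (set0 : set 'rV[R]_k) n = 0.
Proof. by rewrite /Min image_set0 /minimum set0I; apply: xgetPN => x []. Qed.

(** Allowing a multiple of a second functional [e] in the bound serves for
    slices of a hull by a hyperplane on which [e] vanishes. *)
Lemma convex_hull_ge (A : set 'rV[R]_k) (a c : R) e n :
  (forall v, A v -> a + c * pairing v e <= pairing v n) ->
  forall x, convex_hull A x -> a + c * pairing x e <= pairing x n.
Proof.
move=> An _ [m [w [v [Av w0 w1 ->]]]]; rewrite !pairing_sum.
have -> : a + c * \sum_i pairing (w i *: v i) e =
          \sum_i w i * (a + c * pairing (v i) e).
  rewrite -[X in X + _]mul1r -w1 mulr_suml mulr_sumr -big_split /=.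
  by apply: eq_bigr => i _; rewrite pairingZ; ring.
apply: ler_sum => i _; rewrite pairingZ.
by apply: ler_wpM2l => //; exact: An.
Qed.

Lemma sub_convex_hull (A : set 'rV[R]_k) : A `<=` convex_hull A.
Proof.
move=> x Ax; exists 1%N, (fun=> 1), (fun=> x).
by split=> //; rewrite big_ord1 ?scale1r.
Qed.

Lemma convex_hull_midpoint (A : set 'rV[R]_k) x y :
  A x -> A y -> convex_hull A (2^-1 *: (x + y)).
Proof.
move=> Ax Ay; exists 2%N, (fun=> 2^-1), (fun i => if i == 0 then x else y).
split=> [i|i||]; first by case: ifP.
- by rewrite invr_ge0.
- by rewrite !big_ord_recl big_ord0; lra.
- by rewrite !big_ord_recl big_ord0 /= addr0 scalerDr.
Qed.

Definition lattice_hull (s : seq 'rV[int]_k) : set 'rV[R]_k :=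
  convex_hull [set x | exists2 u, u \in s & x = lattice_point u].

Lemma mem_lattice_hull s u : u \in s -> lattice_hull s (lattice_point u).
Proof. by move=> us; apply: sub_convex_hull; exists u. Qed.

Lemma lattice_hull_nil : lattice_hull [::] = set0.
Proof.
rewrite -subset0 => x [[|m] [w [v [sv _ w1 _]]]]; last by case: (sv ord0).
by move: w1; rewrite big_ord0 => /eqP; rewrite eq_sym oner_eq0.
Qed.

Lemma lattice_hull_argmin s n : s != [::] ->
  exists2 u, u \in s & forall x, lattice_hull s x ->
    pairing (lattice_point u) n <= pairing x n.
Proof.
move=> s0; have [|u [us _ umin]] := seq_argmin s xpredT (int_pairing^~ n).
  by rewrite has_predT; case: s s0.
exists u => // x sx; set a := pairing _ n.
have := @convex_hull_ge _ a 0 n n _ x sx.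
rewrite mul0r addr0; apply=> _ [v vs ->]; rewrite {}/a.
by rewrite mul0r addr0 !pairing_lattice_point ler_int umin.
Qed.

Lemma lattice_hull_Min s n : s != [::] ->
  exists2 u, u \in s & Min (lattice_hull s) n = (int_pairing u n)%:~R.
Proof.
move=> /(lattice_hull_argmin n)[u us umin]; exists u => //.
by rewrite -pairing_lattice_point; apply: MinE => //; exact: mem_lattice_hull.
Qed.

Lemma lattice_hull_Min_le s n x :
  lattice_hull s x -> Min (lattice_hull s) n <= pairing x n.
Proof.
have [->|s0] := eqVneq s [::]; first by rewrite lattice_hull_nil.
have [u us umin] := lattice_hull_argmin n s0.
by rewrite (MinE (mem_lattice_hull us) umin); exact: umin.
Qed.

End Pairing.

Arguments lattice_hull {R k} s _.

(** * Generators by height *)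

Section Heights.
Set Implicit Arguments.
Unset Strict Implicit.
Variables (R : realType) (r : nat).
Implicit Types (n : 'cV[int]_r) (t : int) (u : 'rV[int]_(1 + r)).

Definition dual_pair t n : 'cV[int]_(1 + r) := col_mx t%:M n.

Definition vertical : 'cV[int]_(1 + r) := dual_pair 1 0.

Lemma vertical_neq0 : vertical != 0.
Proof.
apply/eqP => /(congr1 (fun l : 'cV[int]_(1 + r) => usubmx l 0 0)).
by rewrite col_mxKu !mxE.
Qed.

Definition height u : int := int_pairing u vertical.

Lemma dual_pairP (l : 'cV[int]_(1 + r)) : exists t n, l = dual_pair t n.
Proof.
exists (usubmx l 0 0), (dsubmx l).
by rewrite /dual_pair -[LHS]vsubmxK [X in col_mx X _ = _]mx11_scalar.
Qed.

Lemma pairing_dual_pair (y : 'rV[R]_(1 + r)) t n :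
  pairing y (dual_pair t n) =
  t%:~R * pairing y vertical + pairing y (dual_pair 0 n).
Proof.
rewrite -[y]hsubmxK [lsubmx y]mx11_scalar !pairing_row_col.
by rewrite {2}/pairing !map_mx0 mulmx0 !mxE; ring.
Qed.

Lemma int_pairing_dual_pair u t n :
  int_pairing u (dual_pair t n) =
  t * height u + int_pairing u (dual_pair 0 n).
Proof.
apply: (@intr_inj R); rewrite rmorphD rmorphM /= /height.
by rewrite -!pairing_lattice_point pairing_dual_pair.
Qed.

Lemma pairing_row0 (x : 'rV[R]_r) t n :
  pairing (row_mx 0 x) (dual_pair t n) = pairing x n.
Proof. by rewrite -(raddf0 scalar_mx) pairing_row_col mul0r add0r. Qed.

Lemma lsubmx_pairing (y : 'rV[R]_(1 + r)) : lsubmx y 0 0 = pairing y vertical.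
Proof.
rewrite -[y in RHS]hsubmxK [lsubmx y in RHS]mx11_scalar pairing_row_col.
by rewrite /pairing !map_mx0 mulmx0 !mxE; ring.
Qed.

Lemma row0_rsubmx (y : 'rV[R]_(1 + r)) :
  pairing y vertical = 0 -> y = row_mx 0 (rsubmx y).
Proof.
rewrite -lsubmx_pairing => y0.
by rewrite -[LHS]hsubmxK [lsubmx y]mx11_scalar y0 raddf0.
Qed.

Lemma pairing_rsubmx (y : 'rV[R]_(1 + r)) n :
  pairing y vertical = 0 -> pairing (rsubmx y) n = pairing y (dual_pair 0 n).
Proof. by move=> y0; rewrite [in RHS](row0_rsubmx y0) pairing_row0. Qed.

Lemma slab_height (s : seq 'rV[int]_(1 + r)) u :
  lattice_hull s `<=` @slab R r -> u \in s ->
  [\/ height u = -1, height u = 0 | height u = 1].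
Proof.
move=> slab_s us; have := slab_s _ (mem_lattice_hull R us).
rewrite /slab /= lsubmx_pairing pairing_lattice_point -/(height u) => h1.
have hu : -1 <= height u <= 1 by rewrite -2!(ler_int R) rmorphN.
have [->|[->|->]] : height u = -1 \/ height u = 0 \/ height u = 1 by lia.
- by constructor 1.
- by constructor 2.
- by constructor 3.
Qed.

(** The width in the vertical direction is at least 2, so generators on both
    walls of the slab exist.  As [minimum] returns 0 on sets without a least
    element, the value 2 is the least of the widths. *)
Lemma generators_on_walls (s : seq 'rV[int]_(1 + r)) :
  lattice_hull s `<=` @slab R r -> lattice_width (lattice_hull s) = 2 :> R ->
  (exists2 p, p \in s & height p = 1) /\ (exists2 q, q \in s & height q = -1).
Proof.
move=> slab_s; rewrite /lattice_width /minimum.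
case: xgetP => [width _ [_ lb_w] w2|_ /eqP]; last by rewrite eq_sym pnatr_eq0.
have := lb_w _ (ex_intro2 _ _ vertical vertical_neq0 erefl); rewrite w2.
have [s0|s0] := eqVneq s [::].
  move: slab_s; rewrite s0 lattice_hull_nil => _.
  by rewrite !Min_set0 oppr0 addr0 => /le_gtF; rewrite ltr0n.
have [p ps ->] := lattice_hull_Min R (- vertical) s0.
have [q qs ->] := lattice_hull_Min R vertical s0.
rewrite -!pairing_lattice_point pairingNr opprK !pairing_lattice_point.
rewrite -/(height p) -/(height q) -rmorphB /= -[leLHS]/(2%:~R) ler_int => pq.
split; [exists p | exists q] => //.
- by case: (slab_height slab_s ps) (slab_height slab_s qs) => ? []; lia.
- by case: (slab_height slab_s ps) (slab_height slab_s qs) => ? []; lia.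
Qed.

(** * The middle polytope *)

Variable s : seq 'rV[int]_(1 + r).
Let P : set 'rV[R]_(1 + r) := lattice_hull s.
Hypothesis slab_s : P `<=` @slab R r.

Lemma middle_lattice_point u :
  u \in s -> height u = 0 -> middle P (rsubmx (lattice_point R u)).
Proof.
move=> us hu; rewrite /middle /= -row0_rsubmx; first exact: mem_lattice_hull.
by rewrite pairing_lattice_point -/(height u) hu.
Qed.

Definition wall_midpoint (p q : 'rV[int]_(1 + r)) : 'rV[R]_(1 + r) :=
  2^-1 *: (lattice_point R p + lattice_point R q).

Lemma pairing_wall_midpoint p q l :
  pairing (wall_midpoint p q) l =
  ((int_pairing p l)%:~R + (int_pairing q l)%:~R) / 2.
Proof. by rewrite pairingZ pairingD !pairing_lattice_point mulrC. Qed.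

Lemma height_wall_midpoint p q : height p = 1 -> height q = -1 ->
  pairing (wall_midpoint p q) vertical = 0.
Proof.
move=> hp hq; rewrite pairing_wall_midpoint -/(height p) -/(height q) hp hq.
by rewrite subrr mul0r.
Qed.

Lemma middle_wall_midpoint p q :
  p \in s -> height p = 1 -> q \in s -> height q = -1 ->
  middle P (rsubmx (wall_midpoint p q)).
Proof.
move=> ps hp qs hq; rewrite /middle /= -row0_rsubmx.
  by apply: convex_hull_midpoint; [exists p | exists q].
exact: height_wall_midpoint.
Qed.

(** The point [x] is either a generator of height 0 or the midpoint of the
    minimizers on the two walls, and so [<x, n>] is half-integral.
    Either way [x] is minimal because the affine function [<x, n> + c h] of the
    height [h], whose slope [c] is half the difference of the minima on the
    walls, bounds [n] from below at each generator. *)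
Lemma middle_Min n p q :
  p \in s -> height p = 1 -> q \in s -> height q = -1 ->
  exists x, [/\ middle P x,
    forall y, middle P y -> pairing x n <= pairing y n &
    pairing x n *+ 2 \is a Num.int].
Proof.
move=> ps hp qs hq; pose f u := int_pairing u (dual_pair 0 n).
have [|{ps hp} p [ps /eqP hp pmin]] :=
  seq_argmin s (fun u => height u == 1) f.
  by apply/hasP; exists p; rewrite ?hp.
have [|{qs hq} q [qs /eqP hq qmin]] :=
  seq_argmin s (fun u => height u == -1) f.
  by apply/hasP; exists q; rewrite ?hq.
(* Minimality on [P0] reduces to an integral condition on the generators. *)
have lower_bound (a : R) : a *+ 2 <= (f p + f q)%:~R ->
    (forall u, u \in s -> height u = 0 -> a <= (f u)%:~R) ->
    forall y, middle P y -> a <= pairing y n.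
  rewrite rmorphD /= => apq a0 y Py.
  rewrite -(pairing_row0 y 0) -[a]addr0.
  rewrite -(mulr0 (((f p)%:~R - (f q)%:~R) / 2)).
  have <- : pairing (row_mx 0 y) vertical = 0 :> R.
    by rewrite pairing_row0 /pairing map_mx0 mulmx0 mxE.
  apply: convex_hull_ge Py => _ [u us ->].
  rewrite !pairing_lattice_point -/(height u) -/(f u).
  have [hu|hu|hu] := slab_height slab_s us; rewrite hu.
  - by have := qmin _ us; rewrite hu -(ler_int R) => /(_ isT); lra.
  - by have := a0 _ us hu; lra.
  - by have := pmin _ us; rewrite hu -(ler_int R) => /(_ isT); lra.
have [/hasP[u0 u0s /andP[/eqP hu0 u0pq]]|no_u0] :=
  boolP (has (fun u => (height u == 0) && (f u *+ 2 < f p + f q)) s).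
  have [|v [vs /eqP hv vmin]] := seq_argmin s (fun u => height u == 0) f.
    by apply/hasP; exists u0; rewrite ?hu0.
  have vE : pairing (rsubmx (lattice_point R v)) n = (f v)%:~R.
    rewrite pairing_rsubmx pairing_lattice_point //.
    by rewrite -/(height v) hv.
  exists (rsubmx (lattice_point R v)).
  rewrite vE; split; first exact: middle_lattice_point.
  - apply: lower_bound => [|u us hu].
      have := vmin _ u0s; rewrite hu0 => /(_ isT) vu0.
      by rewrite -rmorphMn ler_int; lia.
    by rewrite ler_int vmin ?hu.
  - by rewrite rpredMn ?intr_int.
have mE : pairing (rsubmx (wall_midpoint p q)) n *+ 2 = (f p + f q)%:~R.
  rewrite pairing_rsubmx ?height_wall_midpoint // pairing_wall_midpoint.
  by rewrite rmorphD /= -/(f p) -/(f q); lra.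
exists (rsubmx (wall_midpoint p q)).
rewrite mE; split; [exact: middle_wall_midpoint | | exact: intr_int].
apply: lower_bound => [|u us hu]; first by rewrite mE.
move/hasPn: no_u0 => /(_ _ us); rewrite hu eqxx /= -leNgt -(ler_int R).
by rewrite -mE rmorphMn /=; lra.
Qed.

Lemma Min_middle_le n p q x :
  p \in s -> height p = 1 -> q \in s -> height q = -1 ->
  middle P x -> Min (middle P) n <= pairing x n.
Proof.
move=> ps hp qs hq Px; have [x0 [Px0 x0min _]] := middle_Min n ps hp qs hq.
by rewrite (MinE Px0 x0min) x0min.
Qed.

(** Tilting by [t] changes the value at a generator by [t] times its height.
    The choice of [t] makes the minimum on the upper wall equal to
    [floor m], and the midpoint of the minimizers on the walls shows that
    the lower wall is then still at least [2 m - floor m >= floor m]. *)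
Lemma exists_tilt n p q :
  p \in s -> height p = 1 -> q \in s -> height q = -1 ->
  exists t, (Num.floor (Min (middle P) n))%:~R <= Min P (dual_pair t n).
Proof.
move=> ps hp qs hq; pose f u := int_pairing u (dual_pair 0 n).
have m_le x : middle P x -> Min (middle P) n <= pairing x n.
  exact: Min_middle_le ps hp qs hq.
have [|{ps hp} p [ps /eqP hp pmin]] :=
  seq_argmin s (fun u => height u == 1) f.
  by apply/hasP; exists p; rewrite ?hp.
set m := Min (middle P) n in m_le *; pose fm := Num.floor m.
have fm_le : fm%:~R <= m by exact: floor_le.
exists (fm - f p).
have [|u us ->] := @lattice_hull_Min R _ s (dual_pair (fm - f p) n).
  by case: (s) ps.
rewrite ler_int int_pairing_dual_pair -/(f u) -/fm.
have [hu|hu|hu] := slab_height slab_s us; rewrite hu.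
- have := m_le _ (middle_wall_midpoint ps hp us hu).
  rewrite pairing_rsubmx ?height_wall_midpoint // pairing_wall_midpoint.
  rewrite -/(f p) -/(f u) => m_pu.
  have : (fm *+ 2)%:~R <= (f p + f u)%:~R :> R.
    by rewrite rmorphMn rmorphD /=; lra.
  by rewrite ler_int; lia.
- have := m_le _ (middle_lattice_point us hu).
  rewrite pairing_rsubmx ?pairing_lattice_point -/(height u) ?hu // -/(f u).
  by move=> mu; rewrite mulr0 add0r -(ler_int R); apply: le_trans fm_le _.
- by have := pmin _ us; rewrite hu => /(_ isT); lia.
Qed.

End Heights.

(** * The Fine interior at height 0 *)

Section FineInterior.
Set Implicit Arguments.
Unset Strict Implicit.
Variables (R : realType) (r : nat).
Implicit Types P : set 'rV[R]_(1 + r).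

Definition floor_region P : set 'rV[R]_r :=
  [set x | forall n, n != 0 ->
     pairing x n >= (Num.floor (Min (middle P) n))%:~R + 1].

Lemma at_height0I (A B : set 'rV[R]_r) :
  at_height0 A `&` at_height0 B = at_height0 (A `&` B).
Proof.
apply/seteqP; split=> [_ [[x Ax <-] [y By /eq_row_mx[_ yx]]]|_ [x [Ax Bx] <-]].
  by exists x => //; split; rewrite // -yx.
by split; exists x.
Qed.

(** A half-integral [m] that is not an integer satisfies
    [m = floor m + 1/2], so that [2 <x, n> >= 2 m + 1] means
    [<x, n> >= floor m + 1]. *)
Lemma F1I_F2E (s : seq 'rV[int]_(1 + r)) (P := lattice_hull s) p q :
  P `<=` @slab R r ->
  p \in s -> height p = 1 -> q \in s -> height q = -1 ->
  F1 P `&` F2 P = at_height0 (floor_region P).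
Proof.
move=> slabP ps hp qs hq; rewrite at_height0I; congr at_height0.
have half n : exists2 z : int, Min (middle P) n *+ 2 = z%:~R &
    Min (middle P) (n *+ 2) = Min (middle P) n *+ 2.
  have [x [Px xmin /intrP[z xz]]] := middle_Min slabP n ps hp qs hq.
  exists z; rewrite (MinE Px xmin) // -pairing_mulr2n; apply: MinE => // y Py.
  by rewrite !pairing_mulr2n lerMn2r xmin.
have floor_half (m : R) (z : int) : m *+ 2 = z%:~R -> m \isn't a Num.int ->
    m *+ 2 = (Num.floor m *+ 2 + 1)%:~R.
  move=> mz mN; have /andP[fm mf] := floor_itv m.
  have fm' : (Num.floor m)%:~R < m.
    rewrite lt_neqAle fm andbT; apply: contra mN => /eqP <-.
    exact: intr_int.
  rewrite mz; congr intr; move: fm' mf; rewrite !rmorphD /= => fm' mf.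
  have z1 : Num.floor m *+ 2 < z by rewrite -(ltr_int R) -mz rmorphMn /=; lra.
  have z2 : z < Num.floor m *+ 2 + 2.
    by rewrite -(ltr_int R) -mz rmorphD rmorphMn /=; lra.
  by lia.
apply/seteqP; split=> [x [x1 x2] n n0|x xfl].
  have [mint|mN] := boolP (Min (middle P) n \is a Num.int).
    have /intrP[z mz] := mint.
    by have := x1 n (conj n0 mint); rewrite mz intrKfloor.
  have [z mz m2E] := half n.
  have := x2 n (conj n0 mN); rewrite pairing_mulr2n m2E (floor_half _ _ mz mN).
  by rewrite rmorphD rmorphMn /=; lra.
split=> n [n0 mn]; have := xfl n n0.
  by have /intrP[z ->] := mn; rewrite intrKfloor.
have [z mz ->] := half n.
by rewrite pairing_mulr2n (floor_half _ _ mz mn) rmorphD rmorphMn /=; lra.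
Qed.

(** The inclusion from left to right uses one direction over each [n], the tilt
    of [exists_tilt].  Conversely, for every [t] the integer [Min P (t, n)] is at
    most the value of [n] at a point of the middle polytope, so at most the
    floor of the least such value. *)
Lemma Fine_interior_floor (s : seq 'rV[int]_(1 + r)) (P := lattice_hull s) p q :
  P `<=` @slab R r ->
  p \in s -> height p = 1 -> q \in s -> height q = -1 ->
  Fine_interior P = at_height0 (floor_region P).
Proof.
move=> slabP ps hp qs hq.
have s0 : s != [::] by case: (s) ps.
apply/seteqP; split=> [y yP|_ [x xfl <-] l l0].
  have wall (l : 'cV[int]_(1 + r)) :
      (forall u, u \in s -> -1 <= int_pairing u l) -> l != 0 -> 0 <= pairing y l.
    move=> ul /yP; have [u us ->] := lattice_hull_Min R l s0.
    by have := ul u us; rewrite -(ler_int R) rmorphN; lra.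
  have y0 : pairing y (vertical r) = 0.
    apply/eqP; rewrite eq_le -oppr_ge0 -pairingNr.
    rewrite !wall ?oppr_eq0 ?vertical_neq0 //.
    - by move=> u us; case: (slab_height slabP us); rewrite /height; lia.
    - move=> u us; rewrite -(ler_int R) -pairing_lattice_point pairingNr.
      rewrite pairing_lattice_point -rmorphN ler_int.
      by case: (slab_height slabP us); rewrite /height; lia.
  exists (rsubmx y); last by rewrite -row0_rsubmx.
  move=> n n0; have [t fl_le] := exists_tilt slabP n ps hp qs hq.
  have tn0 : dual_pair t n != 0.
    apply: contra n0 => /eqP/(congr1 dsubmx).
    by rewrite col_mxKd => ->; rewrite raddf0.
  have := yP _ tn0; rewrite pairing_dual_pair y0 mulr0 add0r pairing_rsubmx //.
  by apply: le_trans; rewrite lerD2r.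
have [t [n lE]] := dual_pairP l; rewrite lE pairing_row0.
have [n0|n0] := eqVneq n 0.
  have t0 : t != 0.
    by apply: contra l0 => /eqP t0; rewrite lE n0 /dual_pair t0 raddf0 col_mx0.
  have Min_le u : u \in s -> Min P (dual_pair t n) <= (t * height u)%:~R.
    move=> us; apply: le_trans (lattice_hull_Min_le _ (mem_lattice_hull R us)) _.
    rewrite pairing_lattice_point (int_pairing_dual_pair R) n0.
    by rewrite /int_pairing /dual_pair raddf0 col_mx0 mulmx0 mxE addr0.
  have -> : pairing x n = 0 by rewrite n0 /pairing map_mx0 mulmx0 mxE.
  rewrite -lerBrDr sub0r.
  (* The generator on the wall where the direction [(t, 0)] is negative. *)
  have [tneg|tpos] := leP t 0.
    apply: le_trans (Min_le p ps) _.
    by rewrite hp mulr1 -[leRHS]/((-1)%:~R) ler_int; lia.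
  apply: le_trans (Min_le q qs) _.
  by rewrite hq mulrN1 -[leRHS]/((-1)%:~R) ler_int; lia.
apply: le_trans (xfl n n0); rewrite lerD2r.
have [x0 [Px0 x0min _]] := middle_Min slabP n ps hp qs hq.
rewrite (MinE Px0 x0min).
have := lattice_hull_Min_le (dual_pair t n) Px0; rewrite pairing_row0.
have [u us ->] := lattice_hull_Min R (dual_pair t n) s0.
by rewrite ler_int floor_ge_int.
Qed.

End FineInterior.

Theorem theorem2p5 (R : realType) (r : nat) (r_ge1 : (1 <= r)%N)
    (P : set 'rV[R]_(1 + r))
    (P_lattice : lattice_polytope P) (P_full : full_dimensional P)
    (P_width : lattice_width P = 2) (P_slab : P `<=` @slab R r) :
  Fine_interior P = F1 P `&` F2 P /\
  (forall P' : set 'rV[R]_(1 + r),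
     lattice_polytope P' -> full_dimensional P' ->
     lattice_width P' = 2 -> P' `<=` @slab R r ->
     middle P' = middle P -> Fine_interior P' = Fine_interior P).
Proof.
have FE (Q : set 'rV[R]_(1 + r)) : lattice_polytope Q ->
    lattice_width Q = 2 -> Q `<=` @slab R r -> Fine_interior Q = F1 Q `&` F2 Q.
  move=> [s ->] w2 slabQ.
  have [[p ps hp] [q qs hq]] := generators_on_walls slabQ w2.
  by rewrite (F1I_F2E slabQ ps hp qs hq) (Fine_interior_floor slabQ ps hp qs hq).
split=> [|P' P'_lattice _ P'_width P'_slab midE]; first exact: FE.
by rewrite !FE // /F1 /F2 midE.
Qed.
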